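(* For all integers $n,\lambda,r\ge 0$ and $m,x\ge 1$, $$D^{\lambda,x}_{m,r}(n+1)=r\,D^{\lambda,x}_{m,r}(n)+\lambda x\sum_{i=0}^{n}\binom{n}{i}(m+r)^{i}\,D^{\lambda,x}_{m,0}(n-i).$$
   Context: For integers $n,r,\lambda\ge 0$ and $m,x\ge 1$, $D^{\lambda,x}_{m,r}(n)$ (the higher order non-degenerate $r$-Dowling polynomial) is the number of $(r,m,x,\lambda)$-partitions of $\{1,\ldots,n+r\}$, i.e. set partitions of $\{1,\ldots,n+r\}$ carrying the following extra data. (i) The elements $1,\ldots,r$ lie in $r$ distinct blocks, called distinguished blocks; all other blocks are called non-distinguished. (ii) In each non-distinguished block every element except the largest one is colored independently with one of $m$ colors. (iii) Each non-distinguished block is colored independently with one of $x$ colors. (iv) Each non-distinguished block is assigned independently to one of $\lambda$ sections. (v) Neither the distinguished blocks nor their elements are colored. *)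

(* Defs.v *)
From HB Require Import structures.
From mathcomp Require Import all_boot.

Set Implicit Arguments.
Unset Strict Implicit.
Unset Printing Implicit Defensive.

(* The ground set {1, ..., n+r} is represented by 'I_(n + r), with k standing  *)
(* for k.+1; hence the elements 1, ..., r are the i : 'I_(n + r) with i < r.   *)

Section Partitions.

Variables (n r : nat).
Implicit Types (P : {set {set 'I_(n + r)}}) (B : {set 'I_(n + r)}).

Definition distinct_heads P : bool :=
  [forall i : 'I_(n + r), forall j : 'I_(n + r),
     [&& i < r, j < r & i != j] ==> (pblock P i != pblock P j)].

Definition distinguished B : bool := [exists i in B, i < r].

Definition nondistinguished_block P B : bool :=
  (B \in P) && ~~ distinguished B.

Definition is_largest B (e : 'I_(n + r)) : bool :=
  (e \in B) && [forall y in B, y <= e].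

Definition colored_element P (e : 'I_(n + r)) : bool :=
  [exists B, [&& nondistinguished_block P B, e \in B & ~~ is_largest B e]].

End Partitions.

(* The extra data are partial functions (values in an option type) whose      *)
(* domain is exactly the set of objects that carry the corresponding datum,   *)
(* so that equality of data is equality of the decorated partitions.          *)
Record decorated (m r x lambda n : nat) := Decorated {
  parts : {set {set 'I_(n + r)}};
  elt_color : {ffun 'I_(n + r) -> option 'I_m};
  block_color : {ffun {set 'I_(n + r)} -> option 'I_x};
  block_section : {ffun {set 'I_(n + r)} -> option 'I_lambda}
}.

Section DecoratedFinite.

Variables (m r x lambda n : nat).

Definition decorated_tuple (d : decorated m r x lambda n) :=
  (parts d, elt_color d, block_color d, block_section d).

Definition tuple_decorated t : decorated m r x lambda n :=
  let: (P, c, b, s) := t in Decorated P c b s.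

Lemma decorated_tupleK : cancel decorated_tuple tuple_decorated.
Proof. by case. Qed.

HB.instance Definition _ :=
  Finite.copy (decorated m r x lambda n) (can_type decorated_tupleK).

End DecoratedFinite.

Definition is_rmxl_partition (m r x lambda n : nat)
    (d : decorated m r x lambda n) : bool :=
  [&& partition (parts d) [set: 'I_(n + r)],
      distinct_heads (parts d),
      [forall e, isSome (elt_color d e) == colored_element (parts d) e],
      [forall B, isSome (block_color d B)
                   == nondistinguished_block (parts d) B]
    & [forall B, isSome (block_section d B)
                   == nondistinguished_block (parts d) B]].

Definition dowling (m r x lambda n : nat) : nat :=
  #|[set d : decorated m r x lambda n | is_rmxl_partition d]|.

(* Main.v *)
Require Import Defs.
From mathcomp Require Import all_boot.

Set Implicit Arguments.
Unset Strict Implicit.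
Unset Printing Implicit Defensive.

(** Fix the element $a$ of the larger ground set that is new and is not one of
    the $r$ heads $1, ..., r$. Either $a$ shares its block with a head: there
    are $r$ choices for that head, and erasing $a$ leaves an arbitrary
    decorated partition of the smaller ground set. Or the block of $a$ is
    non-distinguished. It then carries one of $x$ colors and one of $\lambda$
    sections; let $U$ consist of the other elements of this block and of all
    the non-heads that lie in distinguished blocks. Each element of $U$ has
    $m + r$ possibilities, namely $m$ colors if it accompanies $a$ and $r$
    heads to join otherwise, and what lies outside $U$ and $a$ is a decorated
    partition without heads. Choosing $U$ of size $i$ gives the $i$-th term of
    the sum.

    In the proof the decorations are first counted away: a partition $P$ carries
    a number of decorations that is a product over the blocks of $P$
    ([dowling_partition_sum]), so that the polynomial becomes a sum over
    partitions of products of block weights. Such sums satisfy one recursion,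
    which splits off the block of a chosen element ([partition_sum_rec]).
    Applied to the heads, it shows that the non-heads in distinguished blocks
    contribute $r^{|S|}$ for the set $S$ of these non-heads
    ([partition_sum_heads]); applied to $a$, it describes a non-distinguished
    block ([partition_sum_tail]). The two contributions merge into
    $(m + r)^{|U|}$ by the binomial theorem in the form [convolution_exp], and
    [partition_sum_new_tail] is the theorem on the level of sets. Finally
    weighted sums over head-free sets depend on the cardinal only
    ([partition_sum_card]), which brings every term back to the polynomials. *)

(** * Sums over the subsets of a finite set *)

Section SubsetSums.
Variable T : finType.
Implicit Types (N R S U : {set T}) (a : T).

Lemma sum_subsets_mem N a (F : {set T} -> nat) : a \notin N ->
  \sum_(B : {set T} | (B \subset a |: N) && (a \in B)) F B
    = \sum_(S : {set T} | S \subset N) F (a |: S).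
Proof.
move=> aN; rewrite (reindex_onto (fun S => a |: S) (fun B => B :\ a)) /=; last first.
  by move=> B /andP[_ aB]; rewrite setD1K.
apply: eq_bigl => S; rewrite setU11 andbT.
apply/andP/idP=> [[sSN /eqP <-]|sSN].
  by rewrite subDset.
by rewrite setUS // setU1K //; apply: contra aN; apply/subsetP.
Qed.

Lemma sum_subsets_notin N a (F : {set T} -> nat) : a \notin N ->
  \sum_(B : {set T} | (B \subset a |: N) && (a \notin B)) F B
    = \sum_(S : {set T} | S \subset N) F S.
Proof.
by move=> aN; apply: eq_bigl => S; rewrite -subsetD1 setU1K.
Qed.

(** The boolean factor is the weight of a block that already contains a head
    and would acquire the elements of $S$. *)
Lemma sum_subsets_cond_disjoint R N (F : {set T} -> nat) : [disjoint R & N] ->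
  \sum_(S : {set T} | S \subset R :|: N) [disjoint S & R] * F S
    = \sum_(S : {set T} | S \subset N) F S.
Proof.
move=> dRN; rewrite big_mkcond [RHS]big_mkcond; apply: eq_bigr => S _.
have -> : (S \subset N) = (S \subset R :|: N) && [disjoint S & R].
  rewrite -[R :|: N]setUC -subsetD setDUl setDv setU0.
  by have /setDidPl -> : [disjoint N & R] by rewrite disjoint_sym.
by case: (S \subset _) => //; case: [disjoint _ & _]; rewrite ?mul1n ?mul0n.
Qed.

Lemma sum_subsets_card N (F : nat -> nat) :
  \sum_(S : {set T} | S \subset N) F #|S| = \sum_(i < #|N|.+1) 'C(#|N|, i) * F i.
Proof.
rewrite (partition_big (fun S : {set T} => inord #|S| : 'I_(#|N|.+1)) predT) //=.
apply: eq_bigr => i _; rewrite -cards_draws -sum1dep_card big_distrl /=.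
have E (S : {set T}) : S \subset N -> (inord #|S| == i) = (#|S| == i).
  by move=> sSN; rewrite -val_eqE /= inordK // ltnS subset_leq_card.
apply: eq_big => S.
  by case sSN: (S \subset N); rewrite //= E.
by case/andP=> sSN; rewrite E // mul1n => /eqP ->.
Qed.

(** The binomial theorem, read as a count of the ways to color each element
    of $N$ with $p + q$ colors. *)
Lemma sum_subsets_exp N p q :
  \sum_(S : {set T} | S \subset N) p ^ #|S| * q ^ #|N :\: S| = (p + q) ^ #|N|.
Proof.
rewrite addnC expnDn -(sum_subsets_card N (fun i => q ^ (#|N| - i) * p ^ i)).
by apply: eq_bigr => S sSN; rewrite mulnC cardsD (setIidPr sSN).
Qed.

(** A pair of disjoint subsets $S$, $S'$ of $N$ amounts to the set
    $U = S \cup S'$ together with its subset $S$. *)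
Lemma sum_disjoint_subsets N (F : {set T} -> {set T} -> nat) :
  \sum_(S : {set T} | S \subset N) \sum_(S' : {set T} | S' \subset N :\: S) F S S'
    = \sum_(U : {set T} | U \subset N) \sum_(S : {set T} | S \subset U) F S (U :\: S).
Proof.
rewrite [RHS](exchange_big_dep (fun S => S \subset N)) /=; last first.
  by move=> U S sUN sSU; apply: subset_trans sUN.
apply: eq_bigr => S sSN.
rewrite [RHS](reindex_onto (fun S' => S :|: S') (fun U => U :\: S)) /=; last first.
  by move=> U /andP[_ sSU]; rewrite setDE setUIr setUCr setIT; apply/setUidPr.
have E (S' : {set T}) : ((S :|: S') :\: S == S') = [disjoint S' & S].
  by rewrite setDUl setDv set0U; apply/eqP/idP => /setDidPl.
apply: eq_big => S'.
  by rewrite E subUset sSN subsetUl subsetD andbT.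
by rewrite subsetD => /andP[_]; rewrite -E => /eqP ->.
Qed.

(** The set form of the fact that a product of exponential generating functions
    $e^{pz} e^{qz} G(z)$ equals $e^{(p+q)z} G(z)$. *)
Lemma convolution_exp N p q (G : {set T} -> nat) :
  \sum_(S : {set T} | S \subset N) p ^ #|S| *
      (\sum_(S' : {set T} | S' \subset N :\: S) q ^ #|S'| * G (N :\: S :\: S'))
    = \sum_(U : {set T} | U \subset N) (p + q) ^ #|U| * G (N :\: U).
Proof.
under eq_bigr do rewrite big_distrr /=.
rewrite (sum_disjoint_subsets N
  (fun S S' => p ^ #|S| * (q ^ #|S'| * G (N :\: S :\: S')))).
apply: eq_bigr => U sUN; rewrite -sum_subsets_exp big_distrl /=.
apply: eq_bigr => S sSU; rewrite mulnA setDDl.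
by congr (_ * G (_ :\: _)); rewrite setDE setUIr setUCr setIT; apply/setUidPr.
Qed.

End SubsetSums.

(** * Weighted sums over set partitions *)

Section PartitionSums.
Variable T : finType.
Implicit Types (A B N S U H R : {set T}) (P Q : {set {set T}}) (a : T).

Definition partition_sum (w : {set T} -> nat) A : nat :=
  \sum_(P : {set {set T}} | partition P A) \prod_(B in P) w B.

Lemma partition_sum0 w : partition_sum w set0 = 1.
Proof.
by rewrite /partition_sum (big_pred1 set0) ?big_set0 // => P; rewrite partition_set0.
Qed.

(** Removing the block $B$ of $a$ is a bijection from the partitions of $A$ in
    which $B$ is that block to the partitions of $A \setminus B$. *)
Lemma partition_sum_rec w A a : a \in A ->
  partition_sum w A
    = \sum_(B : {set T} | (B \subset A) && (a \in B)) w B * partition_sum w (A :\: B).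
Proof.
move=> aA; rewrite /partition_sum.
rewrite (partition_big (fun P => pblock P a) (fun B => (B \subset A) && (a \in B))) /=;
  last first.
  move=> P /and3P[/eqP covP _ _]; rewrite mem_pblock covP aA andbT -covP.
  by rewrite /cover (bigcup_sup (pblock P a)) // pblock_mem // covP.
apply: eq_bigr => B /andP[sBA aB]; rewrite big_distrr /=.
rewrite (reindex_onto (fun Q => B |: Q) (fun P => P :\ B)) /=; last first.
  move=> P /andP[/and3P[/eqP covP _ _] /eqP <-].
  by rewrite setD1K // pblock_mem // covP.
have notinQ Q : partition Q (A :\: B) -> B \notin Q.
  move=> /and3P[/eqP covQ _ _]; apply/negP => BQ.
  have : a \in cover Q by apply/bigcupP; exists B.
  by rewrite covQ inE aB.
have E Q : partition (B |: Q) A && (pblock (B |: Q) a == B) && ((B |: Q) :\ B == Q)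
           = partition Q (A :\: B).
  apply/idP/idP => [/andP[/andP[pP _] /eqP <-]|pQ].
    exact: partitionD1 pP (setU11 _ _).
  have pP : partition (B |: Q) A.
    have -> : A = B :|: A :\: B.
      by rewrite setDE setUIr setUCr setIT; apply/esym/setUidPr.
    apply: partitionU1 => //; first by apply/set0Pn; exists a.
    by rewrite -setI_eq0 setDE setICA setICr setI0.
  rewrite pP setU1K ?notinQ // eqxx andbT /=.
  by case/and3P: pP => _ tP _; rewrite (def_pblock tP _ aB) ?setU11.
apply: eq_big => Q; first exact: E.
by rewrite E => /notinQ BQ; rewrite big_setU1.
Qed.

(** The number of decorations that a block $B$ admits when $H$ is the set of
    heads and each non-distinguished block receives one of $y$ labels. A block
    with two or more heads has weight $0$: this encodes the separation of the
    heads. *)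
Definition dowling_weight m y H B : nat :=
  if [disjoint B & H] then y * m ^ #|B|.-1 else #|B :&: H| == 1.

Variables (m y : nat) (H : {set T}).
Let Z := partition_sum (dowling_weight m y H).

Lemma setDU1U1 a N S : a \notin N -> (a |: N) :\: (a |: S) = N :\: S.
Proof.
move=> aN; apply/setP=> z; rewrite !inE; have [->|] //= := eqVneq z a.
by rewrite (negbTE aN) andbF.
Qed.

(** The recursion for an element $a$ that lies in a head-free set: whichever
    element of its block is the largest, as many elements of the block are
    colored as accompany $a$ there. *)
Lemma partition_sum_tail N a : [disjoint a |: N & H] -> a \notin N ->
  Z (a |: N) = y * \sum_(S : {set T} | S \subset N) m ^ #|S| * Z (N :\: S).
Proof.
move=> dNH aN; rewrite /Z (@partition_sum_rec _ _ a) ?setU11 //.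
rewrite sum_subsets_mem // big_distrr /=; apply: eq_bigr => S sSN.
have aS : a \notin S by apply: contra aN; apply/subsetP.
by rewrite /dowling_weight (disjointWl _ dNH) ?setUS // cardsU1 aS mulnA setDU1U1.
Qed.

(** The block of a head has weight $1$ as long as it contains no other head,
    so only the set $S$ of its non-heads is free. *)
Lemma partition_sum_head R N h :
    h \in H -> R \subset H -> [disjoint N & H] -> h \notin R ->
  Z (h |: (R :|: N)) = \sum_(S : {set T} | S \subset N) Z (R :|: (N :\: S)).
Proof.
move=> hH sRH dNH hR.
have hN : h \notin N by apply/negP => hN; rewrite (disjointFr dNH hN) in hH.
have dRN : [disjoint R & N] by rewrite disjoint_sym (disjointWr sRH).
have hRN : h \notin R :|: N by rewrite inE negb_or hR.
rewrite /Z (@partition_sum_rec _ _ h) ?setU11 // sum_subsets_mem //.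
rewrite -[RHS](sum_subsets_cond_disjoint _ dRN).
apply: eq_bigr => S sS; rewrite setDU1U1 //.
have hS : h \notin S by apply: contra hRN; apply/subsetP.
have -> : dowling_weight m y H (h |: S) = [disjoint S & R].
  rewrite /dowling_weight ifF; last first.
    by apply/negbTE/pred0Pn; exists h; rewrite /= setU11.
  rewrite setIUl (setIidPl _) ?sub1set // cardsU1 inE (negbTE hS) /= eqSS cards_eq0.
  rewrite setI_eq0; congr nat_of_bool.
  apply/idP/idP => [|dSR]; first exact: disjointWr.
  rewrite -setI_eq0 -subset0; apply/subsetP => z; rewrite !inE => /andP[zS zH].
  move/subsetP/(_ _ zS): sS; rewrite inE (disjointFr dSR zS) /= => zN.
  by rewrite (disjointFr dNH zN) in zH.
case: (boolP [disjoint S & R]) => // dSR; rewrite !mul1n setDUl (_ : R :\: S = R) //.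
by apply/setDidPl; rewrite disjoint_sym.
Qed.

(** Here $S$ is the set of the elements of $N$ that lie in distinguished blocks;
    each of them chooses a head. The induction over the heads merges the choice
    of one head ($1^{|S|}$) with that among the $k$ others into
    $(1 + k)^{|S|}$. *)
Lemma partition_sum_heads R N : R \subset H -> [disjoint N & H] ->
  Z (R :|: N) = \sum_(S : {set T} | S \subset N) #|R| ^ #|S| * Z (N :\: S).
Proof.
move cR: #|R| => k; elim: k R N cR => [|k IH] R N.
  move=> /cards0_eq-> _ _; rewrite set0U (bigD1 set0) ?sub0set //=.
  rewrite cards0 expn0 mul1n setD0 big1 ?addn0 // => S /andP[_].
  by rewrite -cards_eq0 -lt0n => /exp0n ->.
move=> cR; have /card_gt0P[h hR] : 0 < #|R| by rewrite cR.
rewrite -{1 2}(setD1K hR) subUset sub1set -setUA => /andP[hH sRH] dNH.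
have cR1 : #|R :\ h| = k by move: cR; rewrite (cardsD1 h) hR => -[].
rewrite partition_sum_head ?setD11 // -add1n -convolution_exp.
apply: eq_bigr => S _; rewrite exp1n mul1n IH ?cR1 //.
by apply: disjointWl dNH; apply: subsetDl.
Qed.

(** The announced recursion, for a new element $a$ outside the heads. In the
    expansion by the set $S$ of the elements of distinguished blocks, the terms
    with $a \in S$ have a factor $|R|$ for the head that $a$ joins; in the
    others the block of $a$ is split off as well. *)
Lemma partition_sum_new_tail R N a :
    R \subset H -> [disjoint a |: N & H] -> a \notin N ->
  Z (R :|: (a |: N)) = #|R| * Z (R :|: N)
    + y * \sum_(U : {set T} | U \subset N) (m + #|R|) ^ #|U| * Z (N :\: U).
Proof.
move=> sRH dNH aN; have dNH' : [disjoint N & H] by apply: disjointWl dNH; apply: subsetUr.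
rewrite !partition_sum_heads // (bigID (fun S => a \in S)) /=; congr (_ + _).
  rewrite sum_subsets_mem // big_distrr /=; apply: eq_bigr => S sSN.
  have aS : a \notin S by apply: contra aN; apply/subsetP.
  by rewrite setDU1U1 // cardsU1 aS expnS mulnA.
rewrite sum_subsets_notin // addnC -convolution_exp big_distrr /=.
apply: eq_bigr => S sSN; rewrite mulnCA; congr (_ * _).
have aS : a \notin S by apply: contra aN; apply/subsetP.
have aNS : a \notin N :\: S by rewrite inE (negbTE aN) andbF.
have -> : (a |: N) :\: S = a |: (N :\: S).
  by rewrite setDUl; congr (_ :|: _); apply/setDidPl; rewrite disjoints1.
rewrite partition_sum_tail //; apply: disjointWl dNH.
by rewrite setUS // subsetDl.
Qed.

End PartitionSums.

(** A reference value for the head-free sets with $k$ elements, with which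
    sets of different ground types can be compared. *)
Definition tail_number m y k : nat :=
  partition_sum (dowling_weight m y set0) [set: 'I_k].

(** One step of the induction below. The values on smaller sets are an abstract
    function $f$ of the cardinal, so that the same step applies to a given set
    and to the standard set of the same size, which live in different types. *)
Lemma partition_sum_tail_card m y (f : nat -> nat) k (T : finType) (H A : {set T}) :
    (forall B : {set T}, B \subset A -> #|B| <= k ->
       partition_sum (dowling_weight m y H) B = f #|B|) ->
    [disjoint A & H] -> #|A| = k.+1 ->
  partition_sum (dowling_weight m y H) A
    = y * \sum_(i < k.+1) 'C(k, i) * (m ^ i * f (k - i)).
Proof.
move=> fE dAH cA; have /card_gt0P[a aA] : 0 < #|A| by rewrite cA.
have cN : #|A :\ a| = k by move: cA; rewrite (cardsD1 a) aA => -[].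
rewrite -{1}(setD1K aA) partition_sum_tail ?setD1K ?setD11 // -cN.
rewrite -(sum_subsets_card (A :\ a) (fun i => m ^ i * f (#|A :\ a| - i))).
congr (_ * _); apply: eq_bigr => S sS.
have cS : #|A :\ a :\: S| = #|A :\ a| - #|S| by rewrite cardsD (setIidPr sS).
rewrite fE ?cS // ?cN ?leq_subr //.
by rewrite setDDl subsetDl.
Qed.

(** Both sides satisfy the same recursion on the cardinal, so strong induction
    applies without a transport of partitions along a bijection. *)
Lemma partition_sum_card m y (T : finType) (H A : {set T}) : [disjoint A & H] ->
  partition_sum (dowling_weight m y H) A = tail_number m y #|A|.
Proof.
have [k] := ubnP #|A|; elim: k => // k IH in T H A *.
rewrite ltnS leq_eqVlt => /orP[/eqP|/IH]; last exact.
case: k IH => [_ /cards0_eq-> _|k IH cA dAH].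
  rewrite cards0 /tail_number (_ : setT = set0) ?partition_sum0 //.
  by apply/setP => -[].
have IH' (T' : finType) (H' A' : {set T'}) : [disjoint A' & H'] ->
    forall B : {set T'}, B \subset A' -> #|B| <= k ->
  partition_sum (dowling_weight m y H') B = tail_number m y #|B|.
  move=> dA' B sB cB; exact: IH cB (disjointWl sB dA').
rewrite (@partition_sum_tail_card m y (tail_number m y) k) //; last exact: IH' dAH.
have d0 : [disjoint [set: 'I_k.+1] & set0] by rewrite disjoint_sym -setI_eq0 set0I.
rewrite /tail_number cA [in RHS](@partition_sum_tail_card m y (tail_number m y) k) //.
  exact: IH' d0.
by rewrite cardsT card_ord.
Qed.

Lemma partition_sum_heads_card m y (T : finType) (H R N : {set T}) :
    R \subset H -> [disjoint N & H] ->
  partition_sum (dowling_weight m y H) (R :|: N)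
    = \sum_(i < #|N|.+1) 'C(#|N|, i) * (#|R| ^ i * tail_number m y (#|N| - i)).
Proof.
move=> sRH dNH; rewrite partition_sum_heads //.
rewrite -(sum_subsets_card N (fun i => #|R| ^ i * tail_number m y (#|N| - i))).
apply: eq_bigr => S sSN; rewrite partition_sum_card; last first.
  by apply: disjointWl dNH; apply: subsetDl.
by rewrite cardsD (setIidPr sSN).
Qed.

(** * Counting decorations block by block *)

Lemma card_partial_functions (I : finType) k (D : pred I) :
  #|[set f : {ffun I -> option 'I_k} | [forall i, isSome (f i) == D i]]|
    = \prod_i (if D i then k else 1).
Proof.
pose Q i := [pred v : option 'I_k | isSome v == D i].
have -> : \prod_i (if D i then k else 1) = \prod_i \sum_(v | Q i v) 1.
  apply: eq_bigr => i _; rewrite sum1_card; case: (D i).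
    transitivity #|predC1 (None : option 'I_k)|; first by rewrite cardC1 card_option card_ord.
    by apply: eq_card => -[v|]; rewrite !inE.
  by rewrite -(card1 (None : option 'I_k)); apply: eq_card => -[v|]; rewrite !inE.
rewrite bigA_distr_big_dep -sum1_card; apply: eq_big => [f|f _]; last first.
  by rewrite big1.
by rewrite inE; apply/forallP/familyP.
Qed.

Section DowlingCount.
Variables n r : nat.
Implicit Types (P : {set {set 'I_(n + r)}}) (B : {set 'I_(n + r)}).

Definition heads : {set 'I_(n + r)} := [set i : 'I_(n + r) | i < r].

Lemma distinguishedE B : distinguished B = ~~ [disjoint B & heads].
Proof.
apply/exists_inP/pred0Pn => [[i iB ir]|[i /andP[/= iB]]].
  by exists i; rewrite /= iB inE.
by rewrite inE => ir; exists i.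
Qed.

Lemma distinct_headsE P : partition P setT ->
  distinct_heads P = [forall B in P, #|B :&: heads| <= 1].
Proof.
case/and3P=> /eqP covP tP _.
apply/forallP/forall_inP => [dP B BP|dP i].
  apply/card_le1P => i; rewrite !inE => /andP[iB ir] j; rewrite !inE.
  apply/idP/eqP => [/andP[jB jr]|->]; last by rewrite iB.
  move/forallP/(_ i): (dP j); rewrite ir jr (def_pblock tP BP iB) (def_pblock tP BP jB).
  by rewrite eqxx implybF negbK => /eqP.
apply/forallP => j; apply/implyP => /and3P[ir jr]; apply: contra => /eqP Eij.
have iB : i \in pblock P i by rewrite mem_pblock covP.
have jB : j \in pblock P i by rewrite Eij mem_pblock covP.
have BP : pblock P i \in P by rewrite pblock_mem ?covP.
by apply/eqP/(card_le1_eqP (dP _ BP)); rewrite !inE ?iB ?jB.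
Qed.

Lemma largest_exists B : B != set0 -> exists e, is_largest B e.
Proof.
case/set0Pn=> e0 e0B.
case: (arg_maxnP (fun i : 'I_(n + r) => val i) e0B) => e eB le.
by exists e; apply/andP; split=> //; apply/forall_inP.
Qed.

(** All elements of a non-distinguished block but its unique largest one are
    colored, whence the exponent. *)
Lemma prod_element_colors P m : partition P setT ->
  \prod_e (if colored_element P e then m else 1)
    = \prod_(B in P) (if distinguished B then 1 else m ^ #|B|.-1).
Proof.
move=> pP; case/and3P: (pP) => /eqP covP tP _.
rewrite -(eq_bigl _ _ (in_setT (T := _))) -covP big_trivIset //=; apply: eq_bigr => B BP.
have colE e : e \in B -> colored_element P e = ~~ distinguished B && ~~ is_largest B e.
  move=> eB; apply/existsP/andP => [[B']|[nd nl]]; last first.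
    by exists B; rewrite /nondistinguished_block BP nd eB.
  case/and3P=> /andP[B'P nd] eB'; move: nd.
  by rewrite -(def_pblock tP B'P eB') (def_pblock tP BP eB).
have [dB|dB] := ifP; first by rewrite big1 // => e eB; rewrite colE // dB.
have [e0 le0] := largest_exists (partition_neq0 pP BP).
have e0B : e0 \in B by case/andP: le0.
rewrite (big_setD1 e0) //= colE // le0 andbF mul1n.
rewrite (cardsD1 e0 B) e0B add1n /= -prod_nat_const.
apply: eq_bigr => e; rewrite !inE => /andP[ne eB]; rewrite colE // dB /=.
rewrite ifT //; apply: contra ne => /andP[_ /forall_inP le].
case/andP: le0 => _ /forall_inP le0.
by rewrite -val_eqE eqn_leq le0 // le.
Qed.

Lemma prod_block_data P k :
  \prod_B (if nondistinguished_block P B then k else 1)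
    = \prod_(B in P) (if distinguished B then 1 else k).
Proof.
rewrite [RHS]big_mkcond; apply: eq_bigr => B _; rewrite /nondistinguished_block.
by case: (B \in P) => //; case: distinguished.
Qed.

(** The three data are chosen independently of each other, each as a partial
    function with a domain prescribed by $P$. *)
Lemma card_decorations m x lambda P :
    partition P setT -> distinct_heads P ->
  #|[set d : decorated m r x lambda n | is_rmxl_partition d && (parts d == P)]|
    = (\prod_e (if colored_element P e then m else 1))
      * (\prod_B (if nondistinguished_block P B then x else 1))
      * (\prod_B (if nondistinguished_block P B then lambda else 1)).
Proof.
move=> pP dP; rewrite -!card_partial_functions -!cardsX.
pose f (t : {ffun 'I_(n + r) -> option 'I_m}
            * {ffun {set 'I_(n + r)} -> option 'I_x}
            * {ffun {set 'I_(n + r)} -> option 'I_lambda}) :=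
  Decorated P t.1.1 t.1.2 t.2.
have injf : injective f by move=> [[c b] s] [[c' b'] s'] [-> -> ->].
rewrite -(card_imset _ injf); apply: eq_card => d; rewrite inE.
apply/idP/imsetP => [/andP[/and5P[_ _ hc hb hs] /eqP dE]|[[[c b] s]]].
  exists (elt_color d, block_color d, block_section d).
    by rewrite !inE /= -dE hc hb hs.
  by case: d dE {hc hb hs} => ? ? ? ? /= ->.
rewrite !inE /= => /andP[/andP[hc hb] hs] ->.
by rewrite /is_rmxl_partition /= pP dP hc hb hs /=.
Qed.

(** If $P$ separates the heads, the three counts of [card_decorations] combine
    to the weight in each block; otherwise no decoration exists, and some block
    with two heads makes the product of the weights vanish. *)
Lemma dowling_partition_sum m x lambda :
  dowling m r x lambda n
    = partition_sum (dowling_weight m (lambda * x) heads) setT.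
Proof.
rewrite /dowling -sum1dep_card /partition_sum.
rewrite (partition_big (@parts _ _ _ _ _) (fun P => partition P setT)) /=; last first.
  by move=> d /and5P[].
apply: eq_bigr => P pP; rewrite sum1dep_card.
have [dP|dP] := boolP (distinct_heads P).
  rewrite card_decorations // prod_element_colors // !prod_block_data -!big_split /=.
  move: dP; rewrite distinct_headsE // => /forall_inP dP.
  apply: eq_bigr => B /dP; rewrite /dowling_weight distinguishedE -setI_eq0 -cards_eq0.
  by case: #|_| => [_|[|]] //=; rewrite mulnC mulnA mulnAC.
rewrite eq_card0; last first.
  by move=> d; rewrite inE; apply/andP => -[/and5P[_ dP' _ _ _] /eqP E]; rewrite -E dP' in dP.
move: dP; rewrite distinct_headsE // negb_forall_in => /exists_inP[B BP].
rewrite -ltnNge => gt1; rewrite (bigD1 B) //= /dowling_weight -setI_eq0 -cards_eq0.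
by case: #|_| gt1 => [|[|]].
Qed.

Lemma card_heads : #|heads| = r.
Proof.
have inj : injective (fun i : 'I_r => widen_ord (leq_addl n r) i).
  by move=> i j /(congr1 val) /= /val_inj.
rewrite -[RHS]card_ord -(card_imset _ inj); apply: eq_card => i; rewrite inE.
apply/idP/imsetP => [ir|[j _ ->]]; last exact: ltn_ord j.
by exists (Ordinal ir) => //; apply: val_inj.
Qed.

Lemma card_tail : #|~: heads| = n.
Proof. by rewrite cardsCs setCK card_heads card_ord addnK. Qed.

Lemma disjoint_tail : [disjoint ~: heads & heads].
Proof. by rewrite disjoints_subset. Qed.

End DowlingCount.

(** * The recurrence *)

Lemma dowling_tail m x lambda n : dowling m 0 x lambda n = tail_number m (lambda * x) n.
Proof.
rewrite dowling_partition_sum partition_sum_card ?cardsT ?card_ord ?addn0 //.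
by rewrite (cards0_eq (card_heads n 0)) disjoint_sym -setI_eq0 set0I.
Qed.

Theorem theorem3p3 (n lambda r m x : nat) (hm : 1 <= m) (hx : 1 <= x) :
  dowling m r x lambda n.+1 =
    r * dowling m r x lambda n
    + lambda * x * \sum_(0 <= i < n.+1)
        'C(n, i) * (m + r) ^ i * dowling m 0 x lambda (n - i).
Proof.
rewrite big_mkord !dowling_partition_sum -!(setUCr (heads _ r)).
have /card_gt0P[a aN] : 0 < #|~: heads n.+1 r| by rewrite card_tail.
have cN : #|~: heads n.+1 r :\ a| = n.
  by have := card_tail n.+1 r; rewrite (cardsD1 a) aN => -[].
have dN : [disjoint ~: heads n.+1 r :\ a & heads n.+1 r].
  by apply: disjointWl (disjoint_tail _ _); apply: subsetDl.
rewrite -{1}(setD1K aN) partition_sum_new_tail ?setD1K ?setD11 ?disjoint_tail //.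
(* The term for $a$ in a distinguished block lives in the larger ground type;
   it agrees with the polynomial at $n$ because both depend on cardinals only. *)
rewrite !partition_sum_heads_card ?disjoint_tail // !card_heads cN card_tail.
congr (_ + _ * _).
under [RHS]eq_bigr do rewrite -mulnA.
have := sum_subsets_card (~: heads n.+1 r :\ a)
  (fun i => (m + r) ^ i * dowling m 0 x lambda (n - i)).
rewrite cN => <-.
apply: eq_bigr => U sU.
rewrite partition_sum_card; last by apply: disjointWl dN; apply: subsetDl.
by rewrite dowling_tail cardsD (setIidPr sU) cN.
Qed.
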